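(* Let $|\mathcal{V}|$ be the pencil of plane cubics over $\mathbb{C}$ generated by $xy^2+yz^2+zx^2$ and $x^3+xyz-y^3$, and let (F6) be Beauville's pencil of plane cubics $x^2y+y^2z+z^2x+t\,xyz=0$, $t\in\mathbb{P}^1$. There is a Cremona transformation $\phi\colon\mathbb{P}^2\dashrightarrow\mathbb{P}^2$ of degree $4$ sending $|\mathcal{V}|$ to (F6).
   Context: We work over $\mathbb{C}$, with homogeneous coordinates $(x:y:z)$ on $\mathbb{P}^2$. A Cremona transformation is a birational self-map of $\mathbb{P}^2$; its degree is the common degree of the homogeneous polynomials without common factors defining it. The pencil (F6) is the one generated by $x^2y+y^2z+z^2x$ and $xyz$, the latter corresponding to $t=\infty$. A Cremona transformation sends a pencil to another one if it maps the general member of the first pencil birationally onto a general member of the second (via the closure of the image), so that it identifies the two pencils up to an automorphism of the parameter space $\mathbb{P}^1$. *)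

(* Defs.v *)
From HB Require Import structures.
From mathcomp Require Import all_boot all_order all_algebra.
From mathcomp Require Import classical_sets reals complex.
From mathcomp Require Import mpoly.

Set Implicit Arguments.
Unset Strict Implicit.
Unset Printing Implicit Defensive.

Import GRing.Theory.

Local Open Scope ring_scope.
Local Open Scope classical_set_scope.

Section Projective.
Variable K : fieldType.

                                                                                
                                                                                
                                                                                
                                                                                
Definition ppoint (n : nat) := {v : 'rV[K]_n.+1 | v != 0}.

Definition same_point n (P Q : ppoint n) : Prop :=
  exists2 c : K, c != 0 & val Q = c *: val P.

Definition peval n (F : {mpoly K[n.+1]}) (P : ppoint n) : K := F.@[val P 0].

                                              
Definition zero_locus n (F : {mpoly K[n.+1]}) : set (ppoint n) :=
  [set P : ppoint n | peval F P = 0].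

Definition zclosure n (S : set (ppoint n)) : set (ppoint n) :=
  [set P : ppoint n | forall (d : nat) (F : {mpoly K[n.+1]}),
    F \is d.-homog -> S `<=` zero_locus F -> peval F P = 0].

Definition zclosed n (Z : set (ppoint n)) : Prop := zclosure Z `<=` Z.

Definition dense_open_in n (X U : set (ppoint n)) : Prop :=
  (exists2 Z, zclosed Z & U = X `\` Z) /\ X `<=` zclosure U.

                                                                                
                                                                                
Definition form_triple (d : nat) (f : 3.-tuple {mpoly K[3]}) : Prop :=
  forall i, tnth f i \is d.-homog.

                                                                                
Definition maps_to (f : 3.-tuple {mpoly K[3]}) (P Q : ppoint 2) : Prop :=
  exists2 c : K, c != 0 & \row_i peval (tnth f i) P = c *: val Q.

                                                            
Definition closed_image (f : 3.-tuple {mpoly K[3]}) (X : set (ppoint 2)) :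
  set (ppoint 2) :=
  zclosure [set Q : ppoint 2 | exists2 P, X P & maps_to f P Q].

                                                                        
Definition rational_retract (X Y : set (ppoint 2))
    (f g : 3.-tuple {mpoly K[3]}) : Prop :=
  exists2 U, dense_open_in X U &
    forall P, U P -> exists2 Q, Y Q & maps_to f P Q /\ maps_to g Q P.

Definition birational_onto (X Y : set (ppoint 2))
    (f : 3.-tuple {mpoly K[3]}) : Prop :=
  exists (e : nat) (g : 3.-tuple {mpoly K[3]}),
    [/\ form_triple e g, rational_retract X Y f g & rational_retract Y X g f].

Definition no_common_factor (f : 3.-tuple {mpoly K[3]}) : Prop :=
  forall h : {mpoly K[3]},
    (forall i, exists k, tnth f i = h * k) -> exists2 c : K, c != 0 & h = c%:MP.

Definition cremona (d : nat) (f : 3.-tuple {mpoly K[3]}) : Prop :=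
  [/\ form_triple d f, no_common_factor f & birational_onto setT setT f].

                                                                                
                                                                                
Definition pencil := ({mpoly K[3]} * {mpoly K[3]})%type.

Definition member (A : pencil) (l : 'rV[K]_2) : set (ppoint 2) :=
  zero_locus (l 0 0 *: A.1 + l 0 1 *: A.2).

                                                                                
                                                                                
Definition sends_pencil (f : 3.-tuple {mpoly K[3]}) (A B : pencil) : Prop :=
  exists2 M : 'M[K]_2, M \in unitmx &
  exists E : seq (ppoint 1), forall l : ppoint 1,
    (forall e, e \in E -> ~ same_point e l) ->
    closed_image f (member A (val l)) = member B (val l *m M) /\
    birational_onto (member A (val l)) (member B (val l *m M)) f.

Definition pencilV : pencil :=
  let x := 'X_0 in let y := 'X_1 in let z := 'X_2 in
  (x * y ^+ 2 + y * z ^+ 2 + z * x ^+ 2, x ^+ 3 + x * y * z - y ^+ 3).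

Definition pencilF6 : pencil :=
  let x := 'X_0 in let y := 'X_1 in let z := 'X_2 in
  (x ^+ 2 * y + y ^+ 2 * z + z ^+ 2 * x, x * y * z).

End Projective.

(* Main.v *)
Require Import Defs.
From mathcomp Require Import all_boot all_order all_algebra.
From mathcomp Require Import classical_sets boolp reals complex mpoly ring.

(** The transformation comes from the rational elliptic surface on which both
    pencils become the same fibration, with one fibre of type I9.  All nine
    base points of the first pencil are infinitely near to (0:0:1); the members
    of the system of quartics with multiplicity 2 at the first three of them and
    1 at the next three contract, on that surface, three disjoint chains made of
    a section and two components of the I9 fibre, and this leaves the model (F6)
    whose I9 fibre is the triangle XYZ = 0.  The sections are the last
    exceptional curve, the line y = 0 and the conic q = yz + x^2.  With the
    nodal member b = x^3 + xyz - y^3 of the pencil, three quartics of the system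
    are y b, q^2 and y^2 q, and the map is (y b : q^2 : - y^2 q).

    On the chart y = 1 one has q = - Y/Z and b = x q - 1, so x, and then z, is
    recovered from X/Z and Y/Z; clearing denominators gives a quartic inverse.
    The two composites are multiplication by y^3 q^6 and by Y^9 Z^6, hence the
    map is an isomorphism from the complement of y q = 0 onto the complement of
    Y Z = 0.  As b = x q - y^3, the combination b^2 + y^3 b - q^3 factors as
    - y q (x y^2 + y z^2 + z x^2), and so the (F6) form with parameters
    (l : m), evaluated at the image, is - (y q)^3 times the form of the first
    pencil with the same parameters: the map induces the identity on parameters
    ([pencilF6_quartic_map], [pencilV_quartic_inv]).

    For l <> 0 the member (l : m) of each pencil meets the removed curve in at
    most three points, and what is left is the density statement
    [curve_minus_finite]: a plane curve minus finitely many points is dense in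
    it.  Projecting from a point off the curve makes its equation monic in one
    affine variable t over the polynomials in another variable s.  If F vanishes
    on the curve for all but finitely many s, then for those s the equation
    divides a fixed power of F; the remainder of the division of that power by
    the monic equation vanishes for infinitely many s, hence is zero
    ([plane_curve_closure]).  The argument applies to singular and reducible
    members alike.

    Finally the three quartics have no common zero away from the line
    x = y = 0 of the affine space, and a polynomial without zeros away from that
    line is constant, being constant along the lines that avoid it
    ([nonzero_off_axis_const]); so they have no common factor. *)

Set Implicit Arguments.
Unset Strict Implicit.
Unset Printing Implicit Defensive.

Import GRing.Theory.

Local Open Scope ring_scope.
Local Open Scope classical_set_scope.

(** * Leading terms of forms restricted to lines *)

Section TopCoef.
Variable A : comNzRingType.
Implicit Types p q : {poly A}.

Lemma coefM_top a b p q : (size p <= a.+1)%N -> (size q <= b.+1)%N ->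
  (p * q)`_(a + b) = p`_a * q`_b.
Proof.
move=> pa qb; rewrite coefM.
have ha : (a < (a + b).+1)%N by rewrite ltnS leq_addr.
rewrite (bigD1 (Ordinal ha)) //= addKn big1 ?addr0 // => i ni.
have [lt_ia|le_ai] := ltnP i a.
  rewrite [q`__]nth_default ?mulr0 //; apply: leq_trans qb _.
  by rewrite ltn_subRL ltn_add2r.
rewrite [p`__]nth_default ?mul0r //; apply: leq_trans pa _.
by rewrite ltn_neqAle le_ai andbT eq_sym.
Qed.

(** A coefficient in degree [d] that is allowed to vanish: unlike [lead_coef],
    it is multiplicative and additive without side conditions. *)
Definition top_coef d (a : A) p := (size p <= d.+1)%N /\ p`_d = a.

Lemma top_coefM d e a b p q :
  top_coef d a p -> top_coef e b q -> top_coef (d + e) (a * b) (p * q).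
Proof.
move=> [pd <-] [qe <-]; split; last exact: coefM_top.
apply: leq_trans (size_polyMleq _ _) _.
by rewrite -subn1 leq_subLR add1n -addnS -addSn leq_add.
Qed.

Lemma top_coef1 : top_coef 0 1 1.
Proof. by split; rewrite ?size_poly1 // coef1. Qed.

Lemma top_coefX k a p : top_coef 1 a p -> top_coef k (a ^+ k) (p ^+ k).
Proof.
move=> h; elim: k => [|k ih]; first exact: top_coef1.
by rewrite !exprS -[k.+1]add1n; apply: top_coefM.
Qed.

Lemma top_coef_prod (I : Type) (r : seq I) (d : I -> nat) a l :
  (forall i, top_coef (d i) (a i) (l i)) ->
  top_coef (\sum_(i <- r) d i) (\prod_(i <- r) a i) (\prod_(i <- r) l i).
Proof.
move=> h; elim: r => [|i r ih]; first by rewrite !big_nil; exact: top_coef1.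
by rewrite !big_cons; apply: top_coefM.
Qed.

Lemma top_coef_sum (I : eqType) (r : seq I) d a l :
  (forall i, i \in r -> top_coef d (a i) (l i)) ->
  top_coef d (\sum_(i <- r) a i) (\sum_(i <- r) l i).
Proof.
move=> h; split; last first.
  by rewrite coef_sum !big_seq; apply: eq_bigr => i /h [].
rewrite big_seq; elim/big_ind: _ => [|p q hp hq|i /h [] //].
  by rewrite size_poly0.
by apply: leq_trans (size_polyD _ _) _; rewrite geq_max hp.
Qed.

Lemma top_coefC (c : A) : top_coef 0 c c%:P.
Proof. by split; rewrite ?coefC // size_polyC leq_b1. Qed.

Lemma top_coef_linear (u v : A) : top_coef 1 v (u%:P + v *: 'X).
Proof.
split; last by rewrite coefD coefC coefZ coefX mulr1 add0r.
rewrite -mul_polyC addrC size_MXaddC; case: ifP => // _.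
by rewrite ltnS size_polyC leq_b1.
Qed.

End TopCoef.

Section Forms.
Variable K : fieldType.

(** For [S] a polynomial ring in some parameters, [f] the constants and [g] a
    specialization of the parameters, the left-hand side is the value of [F] at
    one point of the line or plane parametrized by [h]. *)
Lemma mmap_retract (S : comNzRingType) n (f : {rmorphism K -> S})
    (g : {rmorphism S -> K}) (h : 'I_n -> S) (F : {mpoly K[n]}) :
  (forall x, g (f x) = x) -> g (mmap f h F) = F.@[fun i => g (h i)].
Proof.
move=> gf; rewrite mevalE /mmap rmorph_sum /=; apply: eq_bigr => m _.
rewrite rmorphM gf rmorph_prod; congr (_ * _); apply: eq_bigr => i _.
by rewrite rmorphXn.
Qed.

Lemma meval_homog n d (F : {mpoly K[n]}) (c : K) (v : 'I_n -> K) :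
  F \is d.-homog -> F.@[fun i => c * v i] = c ^+ d * F.@[v].
Proof.
move=> /dhomogP hF; rewrite !mevalE mulr_sumr !big_seq; apply: eq_bigr => m mF.
under eq_bigr => i _ do rewrite exprMn.
rewrite big_split /= mulrCA; congr (_ * _); rewrite prodrXr /=.
by rewrite -mdegE (hF _ mF).
Qed.

(** On the line [u + t v] the coefficient of [t ^ d] in a form of degree [d] is
    its value at the point at infinity [v] of the line; a point off the curve
    thus makes the equation monic up to a constant. *)
Lemma top_coef_form (A : comNzRingType) (f : {rmorphism K -> A}) n d
    (F : {mpoly K[n]}) (u : 'I_n -> A) (v : 'I_n -> K) :
  F \is d.-homog ->
  top_coef d (f F.@[v])
    (mmap (polyC \o f) (fun i => (u i)%:P + f (v i) *: 'X) F).
Proof.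
move=> /dhomogP hF; rewrite mevalE /mmap rmorph_sum /=.
apply: top_coef_sum => m /hF mF.
rewrite rmorphM -(add0n d); apply: top_coefM; first exact: top_coefC.
rewrite rmorph_prod -mF /= mdegE; apply: top_coef_prod => i.
by rewrite rmorphXn; apply/top_coefX/top_coef_linear.
Qed.

End Forms.

(** * Polynomials over an algebraically closed field *)

Section Closed.
Variable K : closedFieldType.

Lemma dvdp_exp_roots (p q : {poly K}) : p != 0 ->
  (forall x, root p x -> root q x) -> p %| q ^+ (size p).-1.
Proof.
move=> p0 pq; have [rs Ep] := closed_field_poly_normal p.
have lp0 : lead_coef p != 0 by rewrite lead_coef_eq0.
have -> : (size p).-1 = size rs.
  by rewrite Ep size_scale // size_prod_XsubC.
rewrite {1}Ep dvdpZl //.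
have : {subset rs <= root q}.
  move=> x xrs; apply: pq; rewrite Ep rootZ // root_prod_XsubC //.
elim: rs {Ep} => [|x rs ih] rsq; first by rewrite big_nil expr0 dvd1p.
rewrite big_cons exprS dvdp_mul //.
  by rewrite dvdp_XsubCl; apply: rsq; rewrite inE eqxx.
by apply: ih => y yrs; apply: rsq; rewrite inE yrs orbT.
Qed.

Lemma cofinite_eq0 (p : {poly K}) (s : seq K) :
  (forall x, x \notin s -> p.[x] = 0) -> p = 0.
Proof.
move=> hp; apply/eqP; apply: contraT => p0.
have /closed_nonrootP [x] : p * \prod_(a <- s) ('X - a%:P) != 0.
  by rewrite mulf_neq0 // monic_neq0 // monic_prod_XsubC.
rewrite rootM root_prod_XsubC negb_or => /andP[px xs].
by move: px; rewrite /root hp ?eqxx.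
Qed.

(** [F] need not be divisible by [c], which may have multiple factors; but
    [F ^+ n], for [n] the degree of [c], becomes divisible by [c] for each good
    value of the inner variable, and division by a monic polynomial commutes
    with specialization. *)
Lemma plane_curve_closure (c F : {poly {poly K}}) (s : seq K) (a : K) :
  a != 0 -> lead_coef c = a%:P ->
  (forall x, x \notin s -> forall y, c.[y%:P].[x] = 0 -> F.[y%:P].[x] = 0) ->
  forall x y, c.[y%:P].[x] = 0 -> F.[y%:P].[x] = 0.
Proof.
move=> a0 lc hs.
wlog {a a0 lc} cm : c hs / c \is monic.
  move=> wl x y cxy; apply: (wl ((a^-1)%:P *: c)).
  - move=> x' x's y'; rewrite !hornerE => /eqP; rewrite mulf_eq0 invr_eq0.
    by rewrite (negPf a0) => /eqP; exact: hs.
  - by rewrite monicE lead_coefZ lc -polyCM mulVf.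
  - by rewrite !hornerE cxy mulr0.
pose n := (size c).-1; pose r := Pdiv.Ring.rmodp (F ^+ n) c.
have Er : F ^+ n = Pdiv.Ring.rdivp (F ^+ n) c * c + r.
  exact: Pdiv.RingMonic.rdivp_eq.
have szr : (size r < size c)%N.
  by rewrite Pdiv.Ring.ltn_rmodpN0 // monic_neq0.
suff r0 : r = 0.
  move=> x y cxy; have := congr1 (fun p : {poly {poly K}} => p.[y%:P].[x]) Er.
  rewrite r0 addr0 !hornerE cxy mulr0 => /eqP.
  by rewrite expf_eq0 => /andP[_ /eqP].
have hE x y (p : {poly {poly K}}) :
    (map_poly (horner_eval x) p).[y] = p.[y%:P].[x].
  rewrite -[y in LHS](hornerC y x) -/(horner_eval x y%:P) horner_map.
  by rewrite /horner_eval.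
apply/polyP => i; rewrite coef0; apply: (@cofinite_eq0 _ s) => x xs.
pose phi : {rmorphism {poly {poly K}} -> {poly K}} := map_poly (horner_eval x).
(* Monicity keeps the degree of [c] under specialization at [x]. *)
have scE : size (phi c) = size c.
  by rewrite size_map_poly_id0 // (monicP cm) rmorph1 oner_neq0.
have : phi c %| phi r.
  have dF : phi c %| phi (F ^+ n).
    rewrite rmorphXn /n -scE; apply: dvdp_exp_roots => [|y].
      by rewrite -size_poly_eq0 scE size_poly_eq0 monic_neq0.
    by rewrite /root !hE => /eqP /(hs _ xs) ->.
  by move: dF; rewrite {1}Er rmorphD rmorphM /= dvdp_addr // dvdp_mull.
have [/eqP p0 _|p0 /(dvdp_leq p0)] := boolP (phi r == 0).
  by have := congr1 (fun p : {poly K} => p`_i) p0; rewrite coef_map coef0.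
rewrite leqNgt scE (leq_ltn_trans _ szr) //; exact: size_poly.
Qed.

Local Notation widen := (widen_ord (leqnSn _)).

(** As a polynomial in the last variable, [p] has a nonzero coefficient; by
    induction this coefficient is nonzero at some point, and there remains a
    nonzero polynomial in one variable. *)
Lemma mpoly_eval_neq0 n (p : {mpoly K[n]}) : p != 0 ->
  exists v : 'I_n -> K, p.@[v] != 0.
Proof.
elim: n p => [|n ih] p p0.
  exists (fun=> 0); apply: contra p0; rewrite (nvar0_mpolyC p) mevalC => /eqP ->.
  by rewrite mpolyC0.
(* The exponent of the last variable and [res m] together determine [m], so
   each coefficient of [muni p] collects distinct monomials. *)
pose res (m : 'X_{1..n.+1}) : 'X_{1..n} := [multinom (m (widen i)) | i < n].
have res_inj m m' : res m = res m' -> m ord_max = m' ord_max -> m = m'.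
  move=> e e'; apply/mnmP => i; case: (unliftP ord_max i) => [j|] -> //.
  have := congr1 (fun m : 'X_{1..n} => m j) e; rewrite !mnmE.
  by congr (m _ = m' _); apply: val_inj; rewrite /= /bump leqNgt ltn_ord.
have mp := mlead_supp p0; set m := mlead p in mp.
have : (muni p)`_(m ord_max) != 0.
  apply/eqP => /(congr1 (fun q : {mpoly K[n]} => q@_(res m))).
  rewrite mcoeff0 muniE coef_sum raddf_sum /= (bigD1_seq m) ?msupp_uniq //=.
  rewrite big1_seq ?addr0.
    rewrite !coefZ coefXn eqxx mulr1 mcoeffZ mcoeffX eqxx mulr1 => /eqP.
    by rewrite mcoeff_eq0 mp.
  move=> m' /andP[ne _]; rewrite !coefZ coefXn.
  have [e|_] := eqVneq; last by rewrite mulr0 mcoeff0.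
  rewrite mulr1 mcoeffZ mcoeffX; have [e'|_] := eqVneq; last by rewrite mulr0.
  by case/eqP: ne; apply: res_inj.
case/ih => v hv.
have /closed_nonrootP [t ht] : map_poly (meval v) (muni p) != 0.
  apply: contra hv => /eqP /(congr1 (fun q : {poly K} => q`_(m ord_max))).
  by rewrite coef_map coef0 /= => ->.
exists (fun i => oapp v t (unlift ord_max i)).
apply: contra ht => /eqP ev; apply/rootP; rewrite -{}[RHS]ev.
rewrite muniE mevalE raddf_sum horner_sum; apply: eq_bigr => m' _ /=.
rewrite !map_polyZ map_polyXn !hornerE /= mevalZ mevalX big_ord_recr /=.
rewrite unlift_none mulrA; congr (_ * _ * _); apply: eq_bigr => i _.
rewrite mnmE; congr (_ ^+ _).
have -> : widen i = lift ord_max i.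
  by apply: val_inj; rewrite /= /bump leqNgt ltn_ord.
by rewrite liftK.
Qed.

End Closed.

(** * Dense open subsets of the plane and of plane curves *)

Section Density.
Variable K : closedFieldType.

Lemma meval_rowZ n d (F : {mpoly K[n]}) (c : K) (v : 'rV[K]_n) :
  F \is d.-homog -> F.@[(c *: v) 0] = c ^+ d * F.@[v 0].
Proof.
by move=> hF; rewrite -(meval_homog _ _ hF); apply: meval_eq => i; rewrite mxE.
Qed.

Lemma zclosed_zero_locus n d (h : {mpoly K[n.+1]}) :
  h \is d.-homog -> zclosed (zero_locus h).
Proof. by move=> hh P /(_ d h hh); apply. Qed.

Lemma line_poly n (P w : 'rV[K]_n) (F : {mpoly K[n]}) :
  exists p : {poly K}, forall t, p.[t] = F.@[(P + t *: w) 0].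
Proof.
exists (mmap (@polyC K) (fun i => (P 0 i)%:P + w 0 i *: 'X) F) => t.
rewrite -/(horner_eval t _) mmap_retract => [|x]; last exact: hornerC.
by apply: meval_eq => i; rewrite -[LHS]/(_.[t]) !hornerE !mxE mulrC.
Qed.

(** On the line joining a point to a point [O] off the hypersurface, [h] is a
    nonzero polynomial, so [F * h = 0] there forces [F = 0]. *)
Lemma dense_open_plane n d (h : {mpoly K[n.+1]}) (O : 'rV[K]_n.+1) :
  h \is d.-homog -> (0 < d)%N -> h.@[O 0] != 0 ->
  dense_open_in setT (setT `\` zero_locus h).
Proof.
move=> hh d_gt0 hO; split; first by exists (zero_locus h) => //; exact: zclosed_zero_locus hh.
move=> P _ e F hF FU.
have [f fE] := line_poly (val P) (O - val P) F.
have [g gE] := line_poly (val P) (O - val P) h.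
have g0 : g != 0.
  by apply: contra_neq hO => g0; rewrite -[RHS](horner0 1) -g0 gE scale1r addrC subrK.
suff /eqP : f * g = 0.
  rewrite mulf_eq0 (negPf g0) orbF => /eqP f0.
  by have := fE 0; rewrite f0 horner0 scale0r addr0.
apply: (@cofinite_eq0 _ _ [::]) => t _; rewrite hornerM fE gE.
set Q := _ + _; have [->|hQ] := eqVneq h.@[Q 0] 0; first by rewrite mulr0.
have Q0 : Q != 0.
  apply: contra hQ => /eqP ->; rewrite -(scale0r O) (meval_rowZ _ _ hh).
  by rewrite expr0n gtn_eqF ?mul0r.
have -> : F.@[Q 0] = 0 by apply: (FU (exist _ Q Q0)); split => //; exact/eqP.
by rewrite mul0r.
Qed.

Lemma exists_complement (P O : 'rV[K]_3) :
  exists w : 'rV[K]_3, forall a b c : K, a *: P + b *: w + c *: O = 0 -> b = 0.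
Proof.
pose A := col_mx P O.
have [j jA] : exists j, ~~ (row j (1%:M : 'M[K]_3) <= A)%MS.
  apply/existsP; apply: contraT; rewrite negb_exists => /forallP hA.
  have /mxrankS : ((1%:M : 'M[K]_3) <= A)%MS.
    by apply/row_subP => j; rewrite -[(_ <= _)%MS]negbK hA.
  by rewrite mxrank1 leqNgt ltnS rank_leq_row.
exists (row j 1%:M) => a b c e; apply/eqP; apply: contraNT jA => b0.
have -> : row j (1%:M : 'M[K]_3) = (- b^-1 * a) *: P + (- b^-1 * c) *: O.
  apply: (scalerI b0); apply/eqP; rewrite -subr_eq0 -[X in _ == X]e; apply/eqP.
  by apply/rowP => i; rewrite !mxE; field.
by rewrite addmx_sub // scalemx_sub // -addsmxE ?addsmxSl ?addsmxSr.
Qed.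

(** The value of [s] singles out a line through the point [O]; two of these lines
    share no other point, so each point of [S] spoils one value of [s] at
    most. *)
Lemma finite_bad_params (P w O : 'rV[K]_3) (S : seq 'rV[K]_3) :
  (forall a b k : K, a *: P + b *: w + k *: O = 0 -> [/\ a = 0, b = 0 & k = 0]) ->
  exists bad : seq K, forall (s t k : K) v,
    v \in S -> P + s *: w + t *: O = k *: v -> s \in bad.
Proof.
move=> free; elim: S => [|v S [bad hbad]]; first by exists [::].
have [[s1 [t1 [k1 e1]]]|none] :=
    pselect (exists s t k : K, P + s *: w + t *: O = k *: v); last first.
  exists bad => s t k u; rewrite inE => /orP[/eqP ->|/hbad]; last exact.
  by move=> e; case: none; exists s, t, k.
exists (s1 :: bad) => s t k u; rewrite !inE => /orP[/eqP ->|/hbad h /h ->].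
  move=> e; apply/orP; left.
  have [] := free (k1 - k) (k1 * s - k * s1) (k1 * t - k * t1).
    have : k1 *: (P + s *: w + t *: O) - k *: (P + s1 *: w + t1 *: O) = 0.
      by rewrite e e1 !scalerA mulrC subrr.
    by move=> <-; apply/rowP => i; rewrite !mxE; ring.
  move=> /eqP; rewrite subr_eq0 => /eqP kk + _.
  rewrite kk -mulrBr => /eqP; rewrite mulf_eq0 subr_eq0 => /orP[/eqP k0|//].
  move: e; rewrite k0 scale0r -[P]scale1r => /free [/eqP].
  by rewrite oner_eq0.
by rewrite orbT.
Qed.

(** The projection from a point [O] off the curve turns the lines through [O]
    into the values of a parameter [s], finitely many of which meet the removed
    points; [plane_curve_closure] applies to the rest. *)
Lemma curve_minus_finite n e (c h : {mpoly K[3]}) (O : 'rV[K]_3)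
    (S : seq 'rV[K]_3) :
  c \is n.-homog -> h \is e.-homog -> c.@[O 0] != 0 ->
  (forall P : 'rV[K]_3, P != 0 -> c.@[P 0] = 0 -> h.@[P 0] = 0 ->
     exists2 v, v \in S & exists k : K, P = k *: v) ->
  dense_open_in (zero_locus c) (zero_locus c `\` zero_locus h).
Proof.
move=> hc hh cO finS; split.
  by exists (zero_locus h) => //; exact: zclosed_zero_locus hh.
move=> [P P0] cP d F hF FU; have {}cP : c.@[P 0] = 0 by [].
have [w wP] := exists_complement P O.
have free (a b k : K) : a *: P + b *: w + k *: O = 0 -> [/\ a = 0, b = 0 & k = 0].
  move=> eq0; have b0 := wP _ _ _ eq0; move: eq0; rewrite b0 scale0r addr0.
  have [->|a0 eq0] := eqVneq a 0.
    rewrite scale0r add0r => /eqP; rewrite scaler_eq0 => /orP[/eqP -> //|].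
    move=> /eqP O0; case/negP: cO.
    by rewrite O0 -(scale0r P) (meval_rowZ _ _ hc) cP mulr0.
  have EP : P = (- a^-1 * k) *: O.
    apply: (scalerI a0); apply/eqP; rewrite -subr_eq0 -[X in _ == X]eq0; apply/eqP.
    by apply/rowP => i; rewrite !mxE; field.
  move: cP; rewrite EP (meval_rowZ _ _ hc) => /eqP; rewrite mulf_eq0 (negPf cO) orbF.
  rewrite expf_eq0 => /andP[_ /eqP k0]; case/negP: P0.
  by rewrite EP k0 scale0r.
have [bad hbad] := finite_bad_params S free.
(* The form restricted to the plane of the points [P + s w + t O], as a
   polynomial in [t] over the polynomials in [s]. *)
pose sub := mmap ((@polyC {poly K}) \o (@polyC K))
  (fun i => ((P 0 i)%:P + w 0 i *: 'X)%:P + (O 0 i)%:P *: 'X).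
have subE G s t : (sub G).[t%:P].[s] = G.@[(P + s *: w + t *: O) 0].
  pose ev : {rmorphism {poly {poly K}} -> K} :=
    (horner_eval s : {rmorphism _ -> _}) \o (horner_eval t%:P : {rmorphism _ -> _}).
  rewrite -[LHS]/(ev _) mmap_retract => [|x].
    apply: meval_eq => i; rewrite -[LHS]/(_.[_].[_]) !hornerE !mxE; ring.
  by rewrite -[LHS]/(_.[_].[_]) !hornerE.
have [szc lc] := top_coef_form (@polyC K) (fun i => (P 0 i)%:P + w 0 i *: 'X)
  (O 0) hc.
have lcE : lead_coef (sub c) = (c.@[O 0])%:P.
  have n_lt : (n < size (sub c))%N.
    rewrite ltnNge; apply: contra cO => /leq_sizeP /(_ n (leqnn n)).
    by rewrite lc => /eqP; rewrite polyC_eq0.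
  by rewrite -lc lead_coefE (@anti_leq (size (sub c)) n.+1) // szc.
have at0 G : G.@[P 0] = (sub G).[0%:P].[0].
  by rewrite subE !scale0r !addr0.
rewrite /peval /= at0; apply: (plane_curve_closure cO lcE (s := bad)).
  move=> s sbad t; rewrite !subE => cQ; set Q := _ + _ in cQ *.
  have Q0 : Q != 0.
    apply/eqP => e0; have := free 1 s t; rewrite scale1r => /(_ e0) [/eqP].
    by rewrite oner_eq0.
  apply: (FU (exist _ Q Q0)); split => //= hQ.
  have [v vS [k Ek]] := finS _ Q0 cQ hQ.
  by case/negP: sbad; apply: hbad vS Ek.
by rewrite -at0.
Qed.

(** A polynomial in one variable without roots is constant.  The point
    (0, 1, 0) is joined to any point with first coordinate nonzero by a line that
    avoids the axis, so the values at both points agree; this gives equality on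
    a dense set, hence of polynomials. *)
Lemma nonzero_off_axis_const (h : {mpoly K[3]}) :
  (forall P : 'rV[K]_3, h.@[P 0] = 0 -> P 0 0 = 0 /\ P 0 1 = 0) ->
  exists2 c : K, c != 0 & h = c%:MP.
Proof.
move=> hP; pose O : 'rV[K]_3 := delta_mx 0 1.
have off (P : 'rV[K]_3) : P 0 0 != 0 -> h.@[P 0] = h.@[O 0].
  move=> x0; have [p pE] := line_poly O (P - O) h.
  have : size p == 1%N.
    apply: contraT => /closed_rootP [t /rootP]; rewrite pE => /hP; rewrite !mxE /=.
    case=> /eqP; rewrite !(subr0, add0r) mulf_eq0 (negPf x0) orbF => /eqP ->.
    by rewrite mul0r addr0 => /eqP; rewrite oner_eq0.
  move=> /size_poly1P [c c0 pc].
  have := pE 1; have := pE 0; rewrite pc !hornerC scale0r scale1r addr0.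
  by rewrite addrC subrK => <-.
exists h.@[O 0].
  by apply/eqP => /hP [_ /eqP]; rewrite !mxE /= oner_eq0.
(* The factor ['X_0] extends the equality to the points where it is unknown. *)
suff : (h - (h.@[O 0])%:MP) * 'X_0 == 0.
  rewrite mulf_eq0 => /orP[|]; first by rewrite subr_eq0 => /eqP.
  move=> /eqP /(congr1 (meval (fun=> 1))); rewrite mevalXU meval0 => /eqP.
  by rewrite oner_eq0.
apply: contraT => /mpoly_eval_neq0 [v].
rewrite mevalM mevalB mevalC mevalXU.
pose P : 'rV[K]_3 := \row_i v i.
have -> : h.@[v] = h.@[P 0] by apply: meval_eq => i; rewrite mxE.
have [->|x0] := eqVneq (v 0) 0; first by rewrite mulr0 eqxx.
by rewrite off ?subrr ?mul0r ?eqxx // mxE.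
Qed.

End Density.

(** * Rational maps inverse to each other off a curve *)

Section Retracts.
Variable K : fieldType.
Implicit Types (f g : 3.-tuple {mpoly K[3]}) (X Y : set (ppoint K 2)).

Definition ev_triple f (v : 'rV[K]_3) : 'rV[K]_3 := \row_i (tnth f i).@[v 0].

(** Taking the value of [f] as representative of the image point reduces the two
    projective conditions to one identity between vectors. *)
Lemma rational_retract_off f g X Y (h : {mpoly K[3]}) :
  dense_open_in X (X `\` zero_locus h) ->
  (forall P : ppoint K 2, X P -> peval h P != 0 ->
     (exists2 Q, Y Q & val Q = ev_triple f (val P)) /\
     (exists2 c, c != 0 & ev_triple g (ev_triple f (val P)) = c *: val P)) ->
  rational_retract X Y f g.
Proof.
move=> dense fg; exists (X `\` zero_locus h) => // P [XP /eqP hP].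
have [[Q YQ QE] [c c0 gfE]] := fg P XP hP.
exists Q => //; split; first by exists 1; rewrite ?oner_neq0 // scale1r QE.
by exists c => //; rewrite -gfE -QE.
Qed.

(** The retraction of [Y] into [X] makes a dense part of [Y] lie in the image. *)
Lemma closed_imageE f g X Y :
  zclosed Y -> (forall P Q, X P -> maps_to f P Q -> Y Q) ->
  rational_retract Y X g f -> closed_image f X = Y.
Proof.
move=> clY fXY [U [_ YU] hU]; apply/seteqP; split => Q.
  move=> hQ; apply: clY => d F hF YF; apply: hQ hF _ => {}Q [P XP fPQ].
  exact/YF/(fXY P).
move=> /YU hQ d F hF XF; apply: hQ hF _ => {}Q /hU [P XP [_ fPQ]].
by apply: XF; exists P.
Qed.

End Retracts.

(** * The quartic transformation *)

Section Quartic.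
Variable K : closedFieldType.
Local Notation form := {mpoly K[3]}.
Implicit Types (v : 'rV[K]_3) (l : 'rV[K]_2).

Let x : form := 'X_0.
Let y : form := 'X_1.
Let z : form := 'X_2.

Definition conic : form := y * z + x ^+ 2.
Definition nodal_cubic : form := x ^+ 3 + x * y * z - y ^+ 3.

Definition quartic_map : 3.-tuple form :=
  [tuple y * nodal_cubic; conic ^+ 2; - (y ^+ 2 * conic)].

Definition quartic_inv : 3.-tuple form :=
  [tuple - (y * z * (z ^+ 2 + x * y)); y ^+ 2 * z ^+ 2;
         - (y ^+ 3 * z + (z ^+ 2 + x * y) ^+ 2)].

Definition pencil_form (A : pencil K) (l : 'rV[K]_2) : form :=
  l 0 0 *: A.1 + l 0 1 *: A.2.

Lemma dhomogXU (i : 'I_3) : ('X_i : form) \is 1.-homog.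
Proof. by rewrite dhomogX; apply/eqP/mdeg1. Qed.

Lemma dhomogM_eq d e k (p q : form) :
  p \is d.-homog -> q \is e.-homog -> (d + e = k)%N -> p * q \is k.-homog.
Proof. by move=> hp hq <-; apply: dhomogM. Qed.

Lemma dhomogXn_eq d m k (p : form) :
  p \is d.-homog -> (d * m = k)%N -> p ^+ m \is k.-homog.
Proof. by move=> hp <-; apply: dhomogMn. Qed.

Ltac solve_homog :=
  first [ exact: dhomogXU | reflexivity
        | rewrite dhomogN; solve_homog
        | apply: dhomogD; solve_homog
        | apply: dhomogZ; solve_homog
        | apply: dhomogXn_eq; solve_homog
        | apply: dhomogM_eq; solve_homog ].

Lemma quartic_map_homog : form_triple 4 quartic_map.
Proof.
by case=> [[|[|[|//]]] ?]; rewrite (tnth_nth 0) /= /nodal_cubic /conic; solve_homog.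
Qed.

Lemma quartic_inv_homog : form_triple 4 quartic_inv.
Proof. by case=> [[|[|[|//]]] ?]; rewrite (tnth_nth 0) /=; solve_homog. Qed.

Lemma pencilV_homog l : pencil_form (pencilV K) l \is 3.-homog.
Proof. by rewrite /pencil_form /=; solve_homog. Qed.

Lemma pencilF6_homog l : pencil_form (pencilF6 K) l \is 3.-homog.
Proof. by rewrite /pencil_form /=; solve_homog. Qed.

Definition meval_rules :=
  (mevalD, mevalN, mevalM, mevalZ, rmorphXn, mevalXU).

Lemma row3P (u v : 'rV[K]_3) :
  [/\ u 0 0 = v 0 0, u 0 1 = v 0 1 & u 0 2 = v 0 2] -> u = v.
Proof.
case=> h0 h1 h2; apply/rowP => i.
case: i => [[|[|[|//]]] hi].
- by rewrite (_ : Ordinal hi = 0) //; apply: val_inj.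
- by rewrite (_ : Ordinal hi = 1) //; apply: val_inj.
- by rewrite (_ : Ordinal hi = 2) //; apply: val_inj.
Qed.

Lemma ev_quartic_map v (X := v 0 0) (Y := v 0 1) (Z := v 0 2)
    (q := Y * Z + X ^+ 2) (b := X ^+ 3 + X * Y * Z - Y ^+ 3)
    (w := ev_triple quartic_map v) :
  [/\ w 0 0 = Y * b, w 0 1 = q ^+ 2 & w 0 2 = - (Y ^+ 2 * q)].
Proof.
rewrite /w !mxE !(tnth_nth 0) /= /nodal_cubic /conic !meval_rules /=.
by split; rewrite ?mulrN.
Qed.

Lemma ev_quartic_inv v (X := v 0 0) (Y := v 0 1) (Z := v 0 2)
    (w := ev_triple quartic_inv v) :
  [/\ w 0 0 = - (Y * Z * (Z ^+ 2 + X * Y)), w 0 1 = Y ^+ 2 * Z ^+ 2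
    & w 0 2 = - (Y ^+ 3 * Z + (Z ^+ 2 + X * Y) ^+ 2)].
Proof. by rewrite /w !mxE !(tnth_nth 0) /= !meval_rules. Qed.

(** The map is not defined, or contracts curves, along [y * conic = 0] only, and
    likewise its inverse along [y * z = 0]; off these curves both are
    isomorphisms. *)
Definition exc_map : form := y * conic.
Definition exc_inv : form := y * z.

Lemma ev_conic v : conic.@[v 0] = v 0 1 * v 0 2 + v 0 0 ^+ 2.
Proof. by rewrite /conic !meval_rules. Qed.

Lemma ev_exc_map v : exc_map.@[v 0] = v 0 1 * (v 0 1 * v 0 2 + v 0 0 ^+ 2).
Proof. by rewrite /exc_map mevalM mevalXU ev_conic. Qed.

Lemma ev_exc_inv v : exc_inv.@[v 0] = v 0 1 * v 0 2.
Proof. by rewrite /exc_inv mevalM !mevalXU. Qed.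

Lemma ev_pencilV l v (X := v 0 0) (Y := v 0 1) (Z := v 0 2) :
  (pencil_form (pencilV K) l).@[v 0] =
  l 0 0 * (X * Y ^+ 2 + Y * Z ^+ 2 + Z * X ^+ 2) +
  l 0 1 * (X ^+ 3 + X * Y * Z - Y ^+ 3).
Proof. by rewrite /pencil_form /= !meval_rules. Qed.

Lemma ev_pencilF6 l v (X := v 0 0) (Y := v 0 1) (Z := v 0 2) :
  (pencil_form (pencilF6 K) l).@[v 0] =
  l 0 0 * (X ^+ 2 * Y + Y ^+ 2 * Z + Z ^+ 2 * X) + l 0 1 * (X * Y * Z).
Proof. by rewrite /pencil_form /= !meval_rules. Qed.

Lemma quartic_mapK v :
  ev_triple quartic_inv (ev_triple quartic_map v) =
  (v 0 1 ^+ 3 * conic.@[v 0] ^+ 6) *: v.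
Proof.
apply: row3P; have [-> -> ->] := ev_quartic_inv (ev_triple quartic_map v).
have [-> -> ->] := ev_quartic_map v; rewrite !mxE ev_conic.
by split; ring.
Qed.

Lemma quartic_invK v :
  ev_triple quartic_map (ev_triple quartic_inv v) =
  (v 0 1 ^+ 9 * v 0 2 ^+ 6) *: v.
Proof.
apply: row3P; have [-> -> ->] := ev_quartic_map (ev_triple quartic_inv v).
have [-> -> ->] := ev_quartic_inv v; rewrite !mxE.
by split; ring.
Qed.

Lemma pencilF6_quartic_map l v :
  (pencil_form (pencilF6 K) l).@[ev_triple quartic_map v 0] =
  - (exc_map.@[v 0] ^+ 3 * (pencil_form (pencilV K) l).@[v 0]).
Proof.
rewrite ev_pencilF6 ev_pencilV ev_exc_map; have [-> -> ->] := ev_quartic_map v.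
ring.
Qed.

Lemma pencilV_quartic_inv l v :
  (pencil_form (pencilV K) l).@[ev_triple quartic_inv v 0] =
  v 0 1 ^+ 6 * v 0 2 ^+ 3 * (pencil_form (pencilF6 K) l).@[v 0].
Proof.
rewrite ev_pencilF6 ev_pencilV; have [-> -> ->] := ev_quartic_inv v.
ring.
Qed.

Lemma exc_map_homog : exc_map \is 3.-homog.
Proof. by rewrite /exc_map /conic; solve_homog. Qed.

Lemma exc_inv_homog : exc_inv \is 2.-homog.
Proof. by rewrite /exc_inv; solve_homog. Qed.

Definition pt (a b c : K) : 'rV[K]_3 := \row_i [:: a; b; c]`_i.

Lemma ptE a b c : (pt a b c 0 0 = a) * (pt a b c 0 1 = b) * (pt a b c 0 2 = c).
Proof. by rewrite !mxE. Qed.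

Lemma pt_eta v : v = pt (v 0 0) (v 0 1) (v 0 2).
Proof. by apply: row3P; rewrite !ptE. Qed.

Lemma eq_scale_pt X Y Z k a b c :
  X = k * a -> Y = k * b -> Z = k * c -> pt X Y Z = k *: pt a b c.
Proof. by move=> -> -> ->; apply: row3P; rewrite !mxE /=. Qed.

(** The three points are the base point, and the second intersections of the
    member with the line [y = 0] and with the conic, which meet it at the base
    point with multiplicity 2 and 5 respectively. *)
Lemma pencilV_exc l v : l 0 0 != 0 ->
  (pencil_form (pencilV K) l).@[v 0] = 0 -> exc_map.@[v 0] = 0 ->
  exists2 u, u \in [:: pt 0 0 1; pt (l 0 0) 0 (- l 0 1);
                      pt (l 0 1 * l 0 0) (l 0 0 ^+ 2) (- l 0 1 ^+ 2)] &
    exists k : K, v = k *: u.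
Proof.
rewrite ev_pencilV ev_exc_map.
have := pt_eta v; move: (l 0 0) (l 0 1) (v 0 0) (v 0 1) (v 0 2).
move=> a b X Y Z -> a0 hV /eqP; have [Y0 _|Y0] := eqVneq Y 0.
  have /eqP : X ^+ 2 * (a * Z + b * X) = 0 by rewrite -hV Y0; ring.
  rewrite mulf_eq0 expf_eq0 /= => /orP[/eqP X0|/eqP h].
    exists (pt 0 0 1); first by rewrite !inE eqxx.
    by exists Z; apply: eq_scale_pt; rewrite ?mulr0 ?mulr1.
  exists (pt a 0 (- b)); first by rewrite !inE eqxx orbT.
  exists (X / a); apply: eq_scale_pt; [by field | by rewrite mulr0 | apply: (mulfI a0)].
  have -> : a * Z = - (b * X) by apply/eqP; rewrite -addr_eq0 h.
  by field.
rewrite mulf_eq0 (negPf Y0) /= => /eqP q0.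
have YZ : Y * Z = - X ^+ 2 by apply/eqP; rewrite -addr_eq0 q0.
(* On the conic, the equation of the member is [(a X - b Y) Y ^ 2 = 0]. *)
have aX : a * X = b * Y.
  apply: (@mulIf _ (Y ^+ 2)); first by rewrite expf_neq0.
  apply/eqP; rewrite -subr_eq0 -[X in _ == X]hV; apply/eqP.
  have -> : a * (X * Y ^+ 2 + Y * Z ^+ 2 + Z * X ^+ 2) +
    b * (X ^+ 3 + X * Y * Z - Y ^+ 3) = a * X * Y ^+ 2 - b * Y * Y ^+ 2
      + (a * Z + b * X) * (Y * Z + X ^+ 2) by ring.
  by rewrite q0 mulr0 addr0.
exists (pt (b * a) (a ^+ 2) (- b ^+ 2)); first by rewrite !inE eqxx !orbT.
exists (Y / a ^+ 2); apply: eq_scale_pt; last 1 first.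
- apply: (mulfI Y0); rewrite YZ; apply: (@mulfI _ (a ^+ 2)); first by rewrite expf_neq0.
  by rewrite mulrN -exprMn aX; field.
- by apply: (mulfI a0); rewrite aX; field.
- by field.
Qed.

Lemma pencilF6_exc l v : l 0 0 != 0 ->
  (pencil_form (pencilF6 K) l).@[v 0] = 0 -> exc_inv.@[v 0] = 0 ->
  exists2 u, u \in [:: pt 1 0 0; pt 0 1 0; pt 0 0 1] & exists k : K, v = k *: u.
Proof.
rewrite ev_pencilF6 ev_exc_inv.
have := pt_eta v; move: (l 0 0) (l 0 1) (v 0 0) (v 0 1) (v 0 2).
move=> a b X Y Z -> a0 hF /eqP; rewrite mulf_eq0 => /orP[/eqP Y0|/eqP Z0].
  have /eqP : a * (Z ^+ 2 * X) = 0 by rewrite -hF Y0; ring.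
  rewrite mulf_eq0 (negPf a0) mulf_eq0 expf_eq0 /= => /orP[/eqP Z0|/eqP X0].
    exists (pt 1 0 0); first by rewrite !inE eqxx.
    by exists X; apply: eq_scale_pt; rewrite ?mulr0 ?mulr1.
  exists (pt 0 0 1); first by rewrite !inE eqxx !orbT.
  by exists Z; apply: eq_scale_pt; rewrite ?mulr0 ?mulr1.
have /eqP : a * (X ^+ 2 * Y) = 0 by rewrite -hF Z0; ring.
rewrite mulf_eq0 (negPf a0) mulf_eq0 expf_eq0 /= => /orP[/eqP X0|/eqP Y0].
  exists (pt 0 1 0); first by rewrite !inE eqxx orbT.
  by exists Y; apply: eq_scale_pt; rewrite ?mulr0 ?mulr1.
exists (pt 1 0 0); first by rewrite !inE eqxx.
by exists X; apply: eq_scale_pt; rewrite ?mulr0 ?mulr1.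
Qed.

Lemma quartic_map_retract (X Y : set (ppoint K 2)) :
  dense_open_in X (X `\` zero_locus exc_map) ->
  (forall P Q : ppoint K 2, X P -> val Q = ev_triple quartic_map (val P) -> Y Q) ->
  rational_retract X Y quartic_map quartic_inv.
Proof.
move=> dense XY; apply: rational_retract_off dense _ => P XP.
rewrite /peval {1}/exc_map mevalM mevalXU mulf_eq0 negb_or => /andP[Y0 q0].
split; last first.
  by rewrite quartic_mapK; exists (val P 0 1 ^+ 3 * conic.@[val P 0] ^+ 6) => //;
    rewrite mulf_neq0 ?expf_neq0.
have Q0 : ev_triple quartic_map (val P) != 0.
  apply: contra_neq q0 => e; have [_ + _] := ev_quartic_map (val P).
  by rewrite e mxE -ev_conic => /esym /eqP; rewrite expf_eq0 => /eqP.
by exists (exist (fun u : 'rV[K]_3 => u != 0) _ Q0); first exact: XY XP _.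
Qed.

Lemma quartic_inv_retract (X Y : set (ppoint K 2)) :
  dense_open_in Y (Y `\` zero_locus exc_inv) ->
  (forall P Q : ppoint K 2, Y Q -> val P = ev_triple quartic_inv (val Q) -> X P) ->
  rational_retract Y X quartic_inv quartic_map.
Proof.
move=> dense YX; apply: rational_retract_off dense _ => Q YQ.
rewrite /peval ev_exc_inv mulf_eq0 negb_or => /andP[Y0 Z0].
split; last first.
  by rewrite quartic_invK; exists (val Q 0 1 ^+ 9 * val Q 0 2 ^+ 6) => //;
    rewrite mulf_neq0 ?expf_neq0.
have P0 : ev_triple quartic_inv (val Q) != 0.
  apply: contra_neq Y0 => e; have [_ + _] := ev_quartic_inv (val Q).
  rewrite e mxE => /esym /eqP; rewrite mulf_eq0 !expf_eq0 (negPf Z0) orbF.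
  by move/eqP.
by exists (exist (fun u : 'rV[K]_3 => u != 0) _ P0); first exact: YX YQ _.
Qed.

Lemma quartic_birational (X Y : set (ppoint K 2)) :
  dense_open_in X (X `\` zero_locus exc_map) ->
  dense_open_in Y (Y `\` zero_locus exc_inv) ->
  (forall P Q : ppoint K 2, X P -> val Q = ev_triple quartic_map (val P) -> Y Q) ->
  (forall P Q : ppoint K 2, Y Q -> val P = ev_triple quartic_inv (val Q) -> X P) ->
  birational_onto X Y quartic_map.
Proof.
move=> dX dY XY YX; exists 4, quartic_inv; split; first exact: quartic_inv_homog.
- exact: quartic_map_retract.
- exact: quartic_inv_retract.
Qed.

(** If [q = 0] then [b = - y ^ 3], so [q = y b = 0] forces [y = 0], and then
    [x = 0]. *)
Lemma quartic_no_common_factor : no_common_factor quartic_map.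
Proof.
move=> h hf; apply: nonzero_off_axis_const => P hP.
have [f0 f1 _] := ev_quartic_map P.
have fz i : ev_triple quartic_map P 0 i = 0.
  by rewrite mxE; have [k ->] := hf i; rewrite mevalM hP mul0r.
move: f0 f1; rewrite !fz => /esym /eqP f0 /esym /eqP.
rewrite expf_eq0 /= => /eqP q0.
have Y0 : P 0 1 = 0.
  have bE : P 0 0 ^+ 3 + P 0 0 * P 0 1 * P 0 2 - P 0 1 ^+ 3 =
      P 0 0 * (P 0 1 * P 0 2 + P 0 0 ^+ 2) - P 0 1 ^+ 3 by ring.
  move: f0; rewrite bE q0 mulr0 add0r mulrN oppr_eq0 -exprS expf_eq0 => /eqP //.
by move: q0; rewrite Y0 mul0r add0r => /eqP; rewrite expf_eq0 => /eqP.
Qed.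

Lemma quartic_cremona : cremona 4 quartic_map.
Proof.
split; [exact: quartic_map_homog | exact: quartic_no_common_factor |].
apply: quartic_birational => //.
- apply: (dense_open_plane (O := pt 1 1 0)) exc_map_homog _ _ => //.
  by rewrite ev_exc_map !ptE !(mulr0, add0r, expr1n, mul1r) oner_eq0.
- apply: (dense_open_plane (O := pt 0 1 1)) exc_inv_homog _ _ => //.
  by rewrite ev_exc_inv !ptE mul1r oner_eq0.
Qed.

Lemma pencilV_dense l : l 0 0 != 0 ->
  dense_open_in (member (pencilV K) l) (member (pencilV K) l `\` zero_locus exc_map).
Proof.
move=> l0; apply: (curve_minus_finite (O := pt 1 1 0))
  (pencilV_homog l) exc_map_homog _ (fun P _ => pencilV_exc l0 (v := P)).
by rewrite ev_pencilV !ptE; apply: contra_neq l0 => <-; ring.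
Qed.

Lemma pencilF6_dense l : l 0 0 != 0 ->
  dense_open_in (member (pencilF6 K) l) (member (pencilF6 K) l `\` zero_locus exc_inv).
Proof.
move=> l0; apply: (curve_minus_finite (O := pt 1 1 0))
  (pencilF6_homog l) exc_inv_homog _ (fun P _ => pencilF6_exc l0 (v := P)).
by rewrite ev_pencilF6 !ptE; apply: contra_neq l0 => <-; ring.
Qed.

(** The identity of the parameter line works; the excluded parameter (0 : 1)
    is the fibre of type I9. *)
Lemma quartic_sends_pencil : sends_pencil quartic_map (pencilV K) (pencilF6 K).
Proof.
exists 1%:M; first exact: unitmx1.
pose e : 'rV[K]_2 := delta_mx 0 1.
have e0 : e != 0.
  by apply/eqP => /rowP /(_ 1) /eqP; rewrite !mxE /= oner_eq0.
exists [:: exist _ e e0 : ppoint K 1] => l hl.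
have l0 : val l 0 0 != 0.
  apply/eqP => l0; apply: (hl (exist _ e e0)); first by rewrite inE.
  have lE : val l = val l 0 1 *: e.
    apply/rowP => i; rewrite !mxE /=; case: (unliftP 0 i) => [j|] -> /=.
      by rewrite (_ : lift 0 j = 1) ?mulr1 //; case: j => [[|//] ?]; exact: val_inj.
    by rewrite mulr0; exact: l0.
  exists (val l 0 1) => //; apply: contraTneq (valP l) => l1.
  by rewrite lE l1 scale0r eqxx.
rewrite mulmx1; set X := member (pencilV K) _; set Y := member (pencilF6 K) _.
have XY (P Q : ppoint K 2) c : c != 0 -> X P ->
    ev_triple quartic_map (val P) = c *: val Q -> Y Q.
  move=> c0 XP fE; have := pencilF6_quartic_map (val l) (val P).
  have -> : (pencil_form (pencilV K) (val l)).@[val P 0] = 0 by exact: XP.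
  rewrite fE (meval_rowZ _ _ (pencilF6_homog _)) mulr0 oppr0 => /eqP.
  rewrite mulf_eq0 expf_eq0 (negPf c0) andbF.
  by move/eqP.
have fXY (P Q : ppoint K 2) :
    X P -> val Q = ev_triple quartic_map (val P) -> Y Q.
  by move=> XP QE; apply: (XY P Q 1) => //; rewrite ?oner_neq0 // scale1r.
have gYX (P Q : ppoint K 2) :
    Y Q -> val P = ev_triple quartic_inv (val Q) -> X P.
  move=> YQ PE; have := pencilV_quartic_inv (val l) (val Q); rewrite -PE.
  have -> : (pencil_form (pencilF6 K) (val l)).@[val Q 0] = 0 by exact: YQ.
  by rewrite mulr0; exact.
have dX := pencilV_dense l0; have dY := pencilF6_dense l0.
split; last exact: quartic_birational.
apply: closed_imageE (quartic_inv_retract dY gYX).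
  exact: zclosed_zero_locus (pencilF6_homog _).
by move=> P Q XP [c c0 fE]; apply: XY c0 XP _; exact: fE.
Qed.

End Quartic.

Theorem proposition7p4 (R : realType) :
  exists f : 3.-tuple {mpoly (complex R)[3]},
    cremona 4 f /\
    sends_pencil f (pencilV (complex R)) (pencilF6 (complex R)).
Proof.
exists (quartic_map (complex R)); split.
- exact: quartic_cremona.
- exact: quartic_sends_pencil.
Qed.
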